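(* Let $n\ge 0$. The map $E$ restricts to a bijection from the set of odd-special Dyck paths of length $n$ with no special steps to the set of big Schröder paths of length $n$ with no horizontal steps. Moreover, for all integers $j\ge 1$ and $k\ge 0$, $E$ restricts to a bijection from the set of big hybrid paths of length $n$ with exactly $j$ special steps and exactly $k$ horizontal steps to the set of big hybrid paths of length $n$ with exactly $j-1$ special steps and exactly $k+1$ horizontal steps.
   Context: **Paths.** All lattice paths of length $n$ start at $(0,0)$, end at $(n,0)$, never go below the $x$-axis, and consist of upsteps U $=(1,1)$, downsteps $(1,-1)$, and double horizontal steps HH $=(2,0)$. A double horizontal step is treated as one indivisible ''horizontal step'' and contributes $2$ to the length. Each downstep is either ordinary (written D) or carries the label ''special'' (written d); paths with different labels are different. A Dyck path has no horizontal steps. A big Schröder path is a path of upsteps, ordinary downsteps and horizontal steps (no special steps). An odd-special Dyck path is a Dyck path in which an arbitrary subset of the downsteps that leave from odd height (i.e. whose starting height is odd) are labeled special. **Matching upstep.** The upstep matching a downstep $d$ is the rightmost upstep to the left of $d$ that ends at the height from which $d$ leaves. **The map $E$.** If a path has no special steps, $E$ leaves it unchanged. Otherwise take the leftmost special step $s$. (Flatten) If $s$ is immediately preceded by an upstep, replace that upstep and $s$ by one horizontal step HH. (Slide) If $s$ is immediately preceded by a downstep $d$ (necessarily ordinary), let $u$ be the upstep matching $d$ and let $P$ be the (possibly empty) subpath strictly between $u$ and $d$; replace the portion $u\,P\,d\,s$ of the path by HH $P$ D, i.e. replace $u$ with a horizontal step, delete $d$, let $P$ follow the horizontal step, and make $s$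 an ordinary downstep. For the paths below these are the only cases that occur. **Big hybrid paths.** The set of big hybrid paths is the smallest set of paths that contains all odd-special Dyck paths and is closed under $E$. *)

(* Defs.v *)
(* MathComp world, with the bijections between sets of mathcomp-classical. *)
From HB Require Import structures.
From mathcomp Require Import all_boot all_order all_algebra.
From mathcomp Require Import classical_sets functions.
Set Implicit Arguments.
Unset Strict Implicit.
Unset Printing Implicit Defensive.

(* [Dn] is the ordinary downstep D and [Sp] the special downstep d; [HH] is
   the double horizontal step (2, 0), one indivisible step. *)
Inductive step : Type := Up | Dn | Sp | HH.

Definition step_eqb (s t : step) : bool :=
  match s, t with
  | Up, Up | Dn, Dn | Sp, Sp | HH, HH => true
  | _, _ => false
  end.

Lemma step_eqP : Equality.axiom step_eqb.
Proof. by case; case; constructor. Qed.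

HB.instance Definition _ := hasDecEq.Build step step_eqP.

Definition dx (s : step) : nat := if s is HH then 2 else 1.

Definition dy (s : step) : int :=
  match s with
  | Up => 1%R
  | Dn | Sp => (-1)%R
  | HH => 0%R
  end.

Definition plength (p : seq step) : nat := \sum_(s <- p) dx s.

(* Ordinate of the point reached after the first [i] steps of [p]; this is the
   height from which the step of index [i] leaves. *)
Definition height (p : seq step) (i : nat) : int :=
  (\sum_(s <- take i p) dy s)%R.

Definition lattice_path (p : seq step) : Prop :=
  (forall i, i <= size p -> (0 <= height p i)%R) /\
  height p (size p) = 0%R.

Definition n_special (p : seq step) : nat := count_mem Sp p.
Definition n_horizontal (p : seq step) : nat := count_mem HH p.

Definition odd_special_dyck (p : seq step) : Prop :=
  [/\ lattice_path p, HH \notin p &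
      forall i, i < size p -> nth HH p i = Sp -> odd `|height p i|%N].

Definition big_schroeder (p : seq step) : Prop :=
  lattice_path p /\ Sp \notin p.

(* Index of the upstep matching the downstep of index [j]: the largest [k < j]
   such that step [k] is an upstep ending at the height from which step [j]
   leaves. *)
Definition matching_upstep (p : seq step) (j : nat) : option nat :=
  ohead (rev [seq k <- iota 0 j |
                (nth HH p k == Up) && (height p k.+1 == height p j)]).

(* [index Sp p] is the position of the leftmost special step, or [size p] if
   there is none. In the cases where neither Flatten nor Slide applies (they
   do not occur for big hybrid paths), [p] is returned unchanged.
   In the Slide case [p = A ++ Up :: P ++ [:: Dn, Sp & B]] with [size A = k],
   [Dn] at index [j] and [Sp] at index [j.+1]. *)
Definition E (p : seq step) : seq step :=
  let i := index Sp p in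
  if i == size p then p else
  if i is j.+1 then
    match nth HH p j with
    | Up => take j p ++ HH :: drop i.+1 p
    | Dn => if matching_upstep p j is Some k then
              take k p ++ HH :: drop k.+1 (take j p) ++ Dn :: drop i.+1 p
            else p
    | Sp | HH => p
    end
  else p.

Inductive big_hybrid : seq step -> Prop :=
| big_hybrid_base p : odd_special_dyck p -> big_hybrid p
| big_hybrid_E p : big_hybrid p -> big_hybrid (E p).

Local Open Scope classical_set_scope.

Definition dyck_no_special (n : nat) : set (seq step) :=
  [set p | [/\ odd_special_dyck p, plength p = n & n_special p = 0]].

Definition schroeder_no_horizontal (n : nat) : set (seq step) :=
  [set p | [/\ big_schroeder p, plength p = n & n_horizontal p = 0]].

Definition hybrids (n j k : nat) : set (seq step) :=
  [set p | [/\ lattice_path p, big_hybrid p, plength p = n,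
               n_special p = j & n_horizontal p = k]].

(* Main.v *)
(* Iterating E on an odd-special Dyck path with m special steps consumes all of
   them after m steps. The result can be described recursively on the arch
   decomposition of the path: an arch with base at even height is either kept,
   or, when its closing downstep is special, becomes HH (if it is empty) or
   U X HH Z D (if it is U X U Z D d with U Z D its last inner arch). The inner
   level, at odd height, carries no HH except the one created by such a slide,
   so the result is uniquely parsable and E^m is injective on these paths. As
   a big hybrid path with j special and k horizontal steps is E^k of an
   odd-special Dyck path with j + k special steps, injectivity of E^(j + k)
   gives that of E, and surjectivity is immediate. *)

Require Import Defs.
From mathcomp Require Import all_boot all_order all_algebra.
From mathcomp Require Import classical_sets functions.
From mathcomp Require Import zify.

Import GRing.Theory.

(** * Lattice paths with an arbitrary starting height *)

Fixpoint path_from (h : int) (p : seq step) : bool :=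
  (0 <= h)%R && (if p is s :: q then path_from (h + dy s)%R q else h == 0%R).

Lemma height_cons s p i : height (s :: p) i.+1 = (dy s + height p i)%R.
Proof. by rewrite /height /= big_cons. Qed.

Lemma height0 p : height p 0 = 0%R.
Proof. by rewrite /height take0 big_nil. Qed.

Lemma path_fromP h p :
  reflect ((forall i, i <= size p -> (0 <= h + height p i)%R) /\
           (h + height p (size p))%R = 0%R) (path_from h p).
Proof.
elim: p h => [|s p IHp] h /=.
  rewrite height0 addr0; apply: (iffP andP) => [[h0 /eqP hE]|[nn ->]].
    by split=> // -[|//] _; rewrite height0 addr0.
  by [].
apply: (iffP andP) => [[h0 /IHp[nn hE]]|[nn hE]].
  split=> [[|i] ilt|]; first by rewrite height0 addr0.
    by rewrite height_cons addrA; apply: nn.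
  by rewrite height_cons addrA.
split; first by have := nn 0 isT; rewrite height0 addr0.
apply/IHp; split=> [i ilt|]; last by rewrite -addrA -height_cons.
by rewrite -addrA -height_cons; apply: nn.
Qed.

Lemma lattice_pathP p : lattice_path p <-> path_from 0%R p.
Proof.
split=> [[nn hE]|/path_fromP[nn hE]].
  by apply/path_fromP; split=> [i /nn|]; rewrite add0r.
by split=> [i /nn|]; rewrite ?add0r // -[LHS]add0r.
Qed.

Lemma path_from_cat h a p q :
  (forall h', path_from h' p -> path_from h' q) ->
  path_from h (a ++ p) -> path_from h (a ++ q).
Proof.
by move=> pq; elim: a h => [|s a IHa] h /=; [apply: pq | case/andP=> -> /IHa].
Qed.

Lemma path_from_ge0 h p : path_from h p -> (0 <= h)%R.
Proof. by case: p => [|s p] /= /andP[]. Qed.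

(** Undoing a Slide lifts [a] by one level; the restored downstep brings the path back to its old
    height after [b] begins. *)
Lemma path_from_unslide h a b :
  path_from h (a ++ Dn :: b) -> path_from (h + 1)%R (a ++ [:: Dn, Sp & b]).
Proof.
elim: a h => [|s a IHa] h /= /andP[h0].
  by move=> pb; have := path_from_ge0 _ _ pb; rewrite addrK pb h0 /= => _; lia.
by move/IHa; rewrite addrAC => ->; rewrite andbT; lia.
Qed.

(** * Shape of one application of [E] and its effect on lengths and counts *)

Inductive E_spec (p : seq step) : seq step -> Prop :=
| E_id : E_spec p p
| E_flatten a b of p = a ++ [:: Up, Sp & b] : E_spec p (a ++ HH :: b)
| E_slide a c b of p = a ++ Up :: c ++ [:: Dn, Sp & b] :
    E_spec p (a ++ HH :: c ++ Dn :: b).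

Lemma EP p : E_spec p (E p).
Proof.
rewrite /E; case: eqP => [_|iN]; first exact: E_id.
have ilt : index Sp p < size p by rewrite ltn_neqAle index_size andbT; apply/eqP.
have iSp : nth HH p (index Sp p) = Sp by apply: nth_index; rewrite -index_mem.
case: (index Sp p) ilt iSp => [|j] jlt jSp; first exact: E_id.
have pE : p = take j p ++ [:: nth HH p j, Sp & drop j.+2 p].
  by rewrite -jSp -!drop_nth ?cat_take_drop // ltnW.
case jE: (nth HH p j) (pE) => pE'; try exact: E_id; first exact: E_flatten.
case mE: (matching_upstep p j) => [k|]; last exact: E_id.
have : k \in [seq k <- iota 0 j |
                (nth HH p k == Up) && (height p k.+1 == height p j)].
  rewrite -mem_rev; move: mE; rewrite /matching_upstep.
  by case: (rev _) => //= x s [->]; rewrite mem_head.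
rewrite mem_filter mem_iota /= add0n => /andP[/andP[/eqP kUp _] kj].
apply: E_slide; rewrite {1}pE'.
rewrite -{1}(cat_take_drop k (take j p)) take_takel ?(ltnW kj) // -catA.
rewrite (drop_nth HH) ?size_takel ?nth_take ?kUp //; lia.
Qed.

Lemma plength_cat p q : plength (p ++ q) = plength p + plength q.
Proof. exact: big_cat. Qed.

Lemma plength_cons s p : plength (s :: p) = dx s + plength p.
Proof. exact: big_cons. Qed.

Lemma plength_E p : plength (E p) = plength p.
Proof.
by case: EP => // [a b|a c b] ->; rewrite !(plength_cat, plength_cons) /=; lia.
Qed.

Lemma count_E p : n_special (E p) + n_horizontal (E p) = n_special p + n_horizontal p.
Proof.
by rewrite /n_special /n_horizontal; case: EP => // [a b|a c b] ->;
   do ?rewrite count_cat /=; lia.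
Qed.

Lemma n_special_E p : n_special p <= (n_special (E p)).+1.
Proof.
by rewrite /n_special; case: EP => // [a b|a c b] ->;
   do ?rewrite count_cat /=; lia.
Qed.

(** Undoing [E] only raises parts of the path, so nonnegativity can be pulled back from a later
    iterate. *)
Lemma lattice_path_E p : lattice_path (E p) -> lattice_path p.
Proof.
rewrite !lattice_pathP; case: EP => // [a b|a c b] ->; apply: path_from_cat => h /=.
  by case/andP=> h0; rewrite addr0 addrK => pb; rewrite h0 pb andbT; lia.
by case/andP=> -> /=; rewrite addr0; apply: path_from_unslide.
Qed.

(** * Values of [E] on explicit factorizations *)

Lemma E_no_special p : Sp \notin p -> E p = p.
Proof. by move=> pN; rewrite /E memNindex // eqxx. Qed.

Lemma E_flattenE a b : Sp \notin a -> E (a ++ [:: Up, Sp & b]) = a ++ HH :: b.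
Proof.
move=> aN; rewrite /E index_cat (negbTE aN) /= size_cat /= addn1.
case: eqP => [|_]; first lia.
rewrite nth_cat ltnn subnn /= take_size_cat //.
by rewrite -(cat_rcons Up) -(cat_rcons Sp) drop_size_cat // !size_rcons.
Qed.

Lemma height_cat a p i : height (a ++ p) (size a + i) = (height a (size a) + height p i)%R.
Proof. by rewrite /height take_size take_cat ltnNge leq_addr /= addKn big_cat. Qed.

(** Every upstep inside the balanced factor [c] ends strictly above its base, so the upstep just
    before [c] is the last candidate. *)
Lemma matching_upstepE a c b : path_from 0%R c ->
  matching_upstep (a ++ Up :: c ++ b) (size a + (size c).+1) = Some (size a).
Proof.
move/path_fromP=> [nn hc].
set p := a ++ _.
have hP i : i <= size c -> height p (size a + i.+1) = (height a (size a) + 1 + height c i)%R.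
  move=> ilt; rewrite height_cat height_cons addrA; congr (_ + _)%R.
  by rewrite /height takel_cat.
rewrite /matching_upstep iotaD filter_cat add0n /= -/p.
have hj : height p (size a + (size c).+1) = (height a (size a) + 1)%R.
  by rewrite hP // -[height c _]add0r hc addr0.
rewrite nth_cat ltnn subnn hj -[in height p _.+1]addn1 hP // height0 addr0 eqxx /=.
(* Candidates before [size a] and after it; the latter lie inside [c] and must be none. *)
set fa := [seq k <- iota 0 (size a) | _]; set fc := filter _ _.
suff -> : fc = [::] by rewrite cats1 rev_rcons.
apply/eqP; rewrite -[_ == _]negbK -has_filter; apply/hasPn.
move=> k; rewrite mem_iota => /andP[ak ka].
apply/negP => /andP[/eqP kUp].
pose i := k - (size a).+1.
have ic : i < size c by rewrite /i; lia.
have kE : k = size a + i.+1 by rewrite /i; lia.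
have iUp : nth HH c i = Up.
  move: kUp; rewrite kE nth_cat ltnNge leq_addr /= addKn /= nth_cat ic //.
have := nn _ (ltnW ic).
rewrite kE -addnS hP //.
have -> : height c i.+1 = (height c i + 1)%R.
  by rewrite /height (take_nth HH) // -cats1 big_cat big_seq1 iUp.
lia.
Qed.

Lemma E_slideE a c b : Sp \notin a -> Sp \notin c -> path_from 0%R c ->
  E (a ++ Up :: c ++ [:: Dn, Sp & b]) = a ++ HH :: c ++ Dn :: b.
Proof.
move=> aN cN cP; have mE := matching_upstepE a c [:: Dn, Sp & b] cP.
set p := a ++ _ in mE *.
have iE : index Sp p = (size a + (size c).+1).+1.
  by rewrite /p index_cat (negbTE aN) /= index_cat (negbTE cN) /=; lia.
have sz : size p = size a + (size c + (size b).+2).+1.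
  by rewrite /p size_cat /= size_cat.
have pE : p = (a ++ Up :: c) ++ [:: Dn, Sp & b] by rewrite /p -catA.
have sE : size a + (size c).+1 = size (a ++ Up :: c) by rewrite size_cat.
rewrite /E iE sz; case: eqP => [|_]; first lia.
rewrite mE.
have ta : take (size a) p = a by rewrite take_size_cat.
have dc : drop (size a).+1 (a ++ Up :: c) = c.
  by rewrite -(cat_rcons Up) drop_size_cat ?size_rcons.
have db : drop (size a + (size c).+1).+2 p = b.
  by rewrite sE pE -(cat_rcons Dn) -(cat_rcons Sp) drop_size_cat ?size_rcons.
by rewrite ta db pE sE nth_cat ltnn subnn /= take_size_cat // dc.
Qed.

(* [conv odd w f]: [w] is a factor of an odd-special Dyck path that starts and
   ends at some height of parity [odd] and never goes below it; [f] is what [E]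
   turns it into once all its special steps are used up. A special step returns
   to an even height; it flattens if the arch it closes is empty, and otherwise
   slides along [z], the interior of the last arch inside that arch. *)
Inductive conv : bool -> seq step -> seq step -> Prop :=
| conv_nil o : conv o [::] [::]
| conv_dyck x x' y y' of conv true x x' & conv false y y' :
    conv false (Up :: x ++ Dn :: y) (Up :: x' ++ Dn :: y')
| conv_flatten y y' of conv false y y' :
    conv false [:: Up, Sp & y] (HH :: y')
| conv_slide x x' z z' y y' of conv true x x' & conv false z z' & conv false y y' :
    conv false (Up :: x ++ Up :: z ++ [:: Dn, Sp & y])
               (Up :: x' ++ HH :: z' ++ Dn :: y')
| conv_odd z z' x x' of conv false z z' & conv true x x' :
    conv true (Up :: z ++ Dn :: x) (Up :: z' ++ Dn :: x').

Lemma conv_no_special o w f : conv o w f -> Sp \notin f.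
Proof.
rewrite -has_pred1; elim=> {o w f} //= [x x' y y'|x x' z z' y y'|z z' x x'] *.
- by rewrite has_cat /= negb_or; apply/andP.
- by rewrite has_cat /= has_cat /= !negb_or; apply/and3P.
- by rewrite has_cat /= negb_or; apply/andP.
Qed.

Lemma conv_path o w f h b : conv o w f -> path_from h b -> path_from h (f ++ b).
Proof.
move=> cwf; elim: cwf h b => {o w f} //=.
- move=> x x' y y' _ IHx _ IHy h b hb; have h0 := path_from_ge0 _ _ hb.
  rewrite h0 -catA; apply: IHx => /=; rewrite addrK IHy // andbT; lia.
- by move=> y y' _ IHy h b hb; rewrite (path_from_ge0 _ _ hb) addr0 IHy.
- move=> x x' z z' y y' _ IHx _ IHz _ IHy h b hb; have h0 := path_from_ge0 _ _ hb.
  rewrite h0 -catA; apply: IHx => /=; rewrite addr0 -catA.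
  have h1 : (0 <= h + 1)%R by lia.
  by rewrite h1; apply: IHz => /=; rewrite h1 addrK IHy.
- move=> z z' x x' _ IHz _ IHx h b hb; have h0 := path_from_ge0 _ _ hb.
  rewrite h0 -catA; apply: IHz => /=; rewrite addrK IHx // andbT; lia.
Qed.

Lemma conv_path0 o w f : conv o w f -> path_from 0%R f.
Proof. by move=> cwf; rewrite -[f]cats0; apply: conv_path cwf _. Qed.

Lemma notin_cat (T : eqType) (x : T) p q :
  (x \notin p ++ q) = (x \notin p) && (x \notin q).
Proof. by rewrite mem_cat negb_or. Qed.

Lemma notin_cons (T : eqType) (x y : T) p :
  (x \notin y :: p) = (x != y) && (x \notin p).
Proof. by rewrite in_cons negb_or. Qed.

(** [E] works from left to right: with [a] free of special steps, the factors of [w] are processed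
    in order, each result joining the prefix. *)
Lemma iter_E_conv o w f a b : conv o w f -> Sp \notin a ->
  iter (n_special w) E (a ++ w ++ b) = a ++ f ++ b.
Proof.
rewrite /n_special => cwf; elim: cwf a b => {o w f} //=.
- move=> x x' y y' cx IHx _ IHy a b aN.
  have := IHx (a ++ [:: Up]) (Dn :: y ++ b).
  have := IHy (a ++ Up :: x' ++ [:: Dn]) b.
  rewrite !(notin_cat, notin_cons) aN (conv_no_special _ _ _ cx) /= => /(_ isT) Ey.
  move=> /(_ isT); move: Ey; do ?rewrite -catA /=; move=> Ey Ex.
  by rewrite count_cat /= !add0n addnC iterD Ex.
- move=> y y' _ IHy a b aN.
  have := IHy (a ++ [:: HH]) b.
  rewrite !(notin_cat, notin_cons) aN -!catA /= => /(_ isT) Ey.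
  by rewrite add0n -iterS iterSr E_flattenE.
- move=> x x' z z' y y' cx IHx cz IHz _ IHy a b aN.
  have := IHx (a ++ [:: Up]) (Up :: z ++ [:: Dn, Sp & y] ++ b).
  have := IHz (a ++ Up :: x' ++ [:: Up]) ([:: Dn, Sp & y] ++ b).
  have := IHy (a ++ Up :: x' ++ HH :: z' ++ [:: Dn]) b.
  have := @E_slideE (a ++ Up :: x') z' (y ++ b).
  have xN := conv_no_special _ _ _ cx; have zN := conv_no_special _ _ _ cz.
  rewrite !(notin_cat, notin_cons) aN xN zN /= => /(_ isT isT (conv_path0 _ _ _ cz)) Es.
  move=> /(_ isT) Ey /(_ isT) Ez /(_ isT) Ex.
  move: Es Ey Ez Ex; do ?rewrite -catA /=; move=> Es Ey Ez Ex.
  rewrite !count_cat /= count_cat /= !add0n.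
  (* [iterD] runs the right summand first: [x], then [z], then the Slide, then [y]. *)
  have -> : count_mem Sp x + (count_mem Sp z + (count_mem Sp y).+1) =
            count_mem Sp y + (1 + (count_mem Sp z + count_mem Sp x)) by lia.
  rewrite !iterD; do ?rewrite -catA /=.
  by rewrite Ex Ez /= Es.
- move=> z z' x x' cz IHz _ IHx a b aN.
  have := IHz (a ++ [:: Up]) (Dn :: x ++ b).
  have := IHx (a ++ Up :: z' ++ [:: Dn]) b.
  rewrite !(notin_cat, notin_cons) aN (conv_no_special _ _ _ cz) /= => /(_ isT) Ex.
  move=> /(_ isT); move: Ex; do ?rewrite -catA /=; move=> Ex Ez.
  by rewrite count_cat /= !add0n addnC iterD Ez.
Qed.

(* [b] may come right after an image of parity [o]: the images have an LL(1)
   grammar, which gives the injectivity of [conv]. *)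
Definition follow (o : bool) (b : seq step) : bool :=
  if b is s :: _ then (s == Dn) || (o && (s == HH)) else ~~ o.

(** The remainders [b1] and [b2] let the induction hypotheses cut off one factor at a time; the next
    letter then identifies the rule. *)
Lemma conv_inj o w1 w2 f1 f2 b1 b2 :
  conv o w1 f1 -> conv o w2 f2 -> follow o b1 -> follow o b2 ->
  f1 ++ b1 = f2 ++ b2 -> w1 = w2 /\ b1 = b2.
Proof.
move=> c1; elim: c1 w2 f2 b1 b2 => {o w1 f1} [o|x x' y y' _ IHx _ IHy|y y' _ IHy|
  x x' z z' y y' _ IHx _ IHz _ IHy|z z' x x' _ IHz _ IHx] w2 f2 b1 b2 c2 F1 F2;
  inversion c2; subst => //=; do ?rewrite -catA /=; move=> e;
  (* An empty image against a nonempty one: [follow] forbids the first letter of the latter. *)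
  try by [move: F1; rewrite e | move: F2; rewrite -e].
- case: e => e.
  have [-> [e']] : x = x0 /\ Dn :: y' ++ b1 = Dn :: y'0 ++ b2 by apply: IHx e.
  by have [-> ->] : y = y0 /\ b1 = b2 by apply: IHy e'.
- case: e => e.
  (* A kept arch and a slid one differ right after [x']: [Dn] against [HH]. *)
  by have [] : x = x0 /\ Dn :: y' ++ b1 = HH :: z' ++ Dn :: y'0 ++ b2
    by apply: IHx e.
- case: e => e.
  by have [-> ->] : y = y0 /\ b1 = b2 by apply: IHy e.
- case: e => e.
  by have [] : x = x0 /\ HH :: z' ++ Dn :: y' ++ b1 = Dn :: y'0 ++ b2
    by apply: IHx e.
- case: e => e.
  have [-> [e']] : x = x0 /\
      HH :: z' ++ Dn :: y' ++ b1 = HH :: z'0 ++ Dn :: y'0 ++ b2 by apply: IHx e.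
  have [-> [e'']] : z = z0 /\ Dn :: y' ++ b1 = Dn :: y'0 ++ b2 by apply: IHz e'.
  by have [-> ->] : y = y0 /\ b1 = b2 by apply: IHy e''.
- case: e => e.
  have [-> [e']] : z = z0 /\ Dn :: x' ++ b1 = Dn :: x'0 ++ b2 by apply: IHz e.
  by have [-> ->] : x = x0 /\ b1 = b2 by apply: IHx e'.
Qed.

(** [conv] builds odd-level factors from the left, whereas Slide needs their last arch. *)
Lemma conv_odd_rcons o w f : conv o w f -> o -> w = [::] \/
  exists x x' z z', [/\ w = x ++ Up :: z ++ [:: Dn], conv true x x' & conv false z z'].
Proof.
elim=> {o w f} // [o|z z' x x' cz _ cx IHx] _; [by left | right].
have [->|[x1 [x1' [z1 [z1' [-> cx1 cz1]]]]]] := IHx isT.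
  by exists [::], [::], z, z'; split=> //; apply: conv_nil.
exists (Up :: z ++ Dn :: x1), (Up :: z' ++ Dn :: x1'), z1, z1'.
by rewrite /= -!catA; split=> //; apply: conv_odd.
Qed.

(** * Parsing odd-special Dyck paths into arches *)

Fixpoint osd_from (h : nat) (p : seq step) : bool :=
  match p, h with
  | [::], 0 => true
  | Up :: q, _ => osd_from h.+1 q
  | Dn :: q, h'.+1 => osd_from h' q
  | Sp :: q, h'.+1 => ~~ odd h' && osd_from h' q
  | _, _ => false
  end.

Lemma odd_special_dyck_from p : odd_special_dyck p -> osd_from 0 p.
Proof.
case=> /lattice_pathP pP pN odds.
have {}odds i : i < size p -> nth HH p i = Sp -> odd `|(Posz 0 + height p i)%R|%N.
  by move=> ilt /(odds i ilt); rewrite add0r.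
rewrite -[0%R]/(Posz 0) in pP.
elim: p 0 pP pN odds => [|s p IHp] h /=.
  by case: h.
rewrite in_cons negb_or => pP /andP[sN pN] odds.
have odds' (h' : nat) : (Posz h + dy s)%R = Posz h' ->
    forall i, i < size p -> nth HH p i = Sp -> odd `|(Posz h' + height p i)%R|%N.
  by move=> <- i ilt /(odds i.+1 ilt); rewrite height_cons addrA.
case: s sN pP odds odds' => //= _ pP odds odds'.
- by apply: IHp => //; [rewrite -addn1 PoszD | apply: odds'; rewrite -addn1 PoszD].
- case: h pP odds odds' => [/path_from_ge0 //|h].
  rewrite -addn1 PoszD addrK => pP odds odds'.
  by apply: IHp => //; apply: odds'.
- case: h pP odds odds' => [/path_from_ge0 //|h].
  rewrite -addn1 PoszD addrK => pP odds odds'.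
  have := odds 0 isT erefl; rewrite height0 addr0 /= addn1 /= => ->.
  by apply: IHp => //; apply: odds'.
Qed.

(** [w] is the longest prefix staying at or above the starting height. Strong induction on length
    parses the interior of the first arch, then what follows its closing step. *)
Lemma osd_from_conv p h : osd_from h p ->
  exists w f b, [/\ p = w ++ b, conv (odd h) w f, osd_from h b & ohead b != Some Up].
Proof.
have [n] := ubnP (size p); elim: n p h => // n IHn p h pn pP.
have [pU|pU] := eqVneq (ohead p) (Some Up); last first.
  by exists [::], [::], p; split=> //; apply: conv_nil.
case: p pU pn pP => // _ p [->]; rewrite ltnS => pn /(IHn _ _ pn)[w [f [b [pE]]]].
have small q s : b = s :: q -> size q < n.
  by move=> bE; move: pn; rewrite pE bE /= size_cat /=; lia.
case: b pE small => // -[] // q pE /(_ q _ erefl) qn /=.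
  move=> cw /(IHn _ _ qn)[w' [f' [b' [qE cw' b'P b'U]]]] _.
  exists (Up :: w ++ Dn :: w'), (Up :: f ++ Dn :: f'), b'.
  rewrite pE qE /= -catA; split=> //.
  by case: (odd h) cw cw' => /= cw cw'; [apply: conv_odd | apply: conv_dyck].
case: (boolP (odd h)) => //= oh cw /(IHn _ _ qn)[w' [f' [b' [qE]]]].
rewrite (negbTE oh) => cw' b'P b'U _.
(* The arch closes with a special step: an empty interior gives Flatten, otherwise its last arch
   gives Slide. *)
have [wE|[x [x' [z [z' [wE cx cz]]]]]] := conv_odd_rcons _ _ _ cw isT.
  exists [:: Up, Sp & w'], (HH :: f'), b'.
  by rewrite pE wE qE; split=> //; apply: conv_flatten.
exists (Up :: x ++ Up :: z ++ [:: Dn, Sp & w']), (Up :: x' ++ HH :: z' ++ Dn :: f'), b'.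
rewrite pE wE qE; split=> //; last exact: conv_slide.
by do ?rewrite -catA /=.
Qed.

Lemma odd_special_dyck_conv p : odd_special_dyck p -> exists f, conv false p f.
Proof.
move=> /odd_special_dyck_from/osd_from_conv[w [f [[|[] b] [-> cwf]]]] //= _ _.
by exists f; rewrite cats0.
Qed.

Lemma iter_n_special_E p f : conv false p f -> iter (n_special p) E p = f.
Proof.
by move=> cpf; have := iter_E_conv _ _ _ [::] [::] cpf isT; rewrite /= !cats0.
Qed.

(** * Iterates of [E] and the description of big hybrid paths *)

Lemma plength_iter_E i p : plength (iter i E p) = plength p.
Proof. by elim: i => // i IHi; rewrite iterS plength_E. Qed.

Lemma count_iter_E i p :
  n_special (iter i E p) + n_horizontal (iter i E p) = n_special p + n_horizontal p.
Proof. by elim: i => // i IHi; rewrite iterS count_E. Qed.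

Lemma n_special_iter_E_le i p : n_special p <= n_special (iter i E p) + i.
Proof.
elim: i => [|i IHi]; first by rewrite addn0.
by rewrite iterS addnS -addSn; apply: leq_trans IHi _; rewrite leq_add2r n_special_E.
Qed.

Lemma lattice_path_iter_E i p : lattice_path (iter i E p) -> lattice_path p.
Proof. by elim: i => // i IHi /lattice_path_E. Qed.

(* [E] removes at most one special step and [n_special p] iterations remove
   them all, so each of these iterations removes exactly one. *)
Lemma n_special_iter_E i p : odd_special_dyck p -> i <= n_special p ->
  n_special (iter i E p) = n_special p - i.
Proof.
move=> /odd_special_dyck_conv[f cpf] ip.
(* The first [i] iterations give the lower bound; the remaining ones, ending with no special step,
   give the upper bound. *)
have := n_special_iter_E_le i p.
have := n_special_iter_E_le (n_special p - i) (iter i E p).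
rewrite -iterD subnK // (iter_n_special_E _ _ cpf).
have /count_memPn : Sp \notin f := conv_no_special _ _ _ cpf.
rewrite -/(n_special f) => ->; lia.
Qed.

Lemma n_horizontal_iter_E i p : odd_special_dyck p -> i <= n_special p ->
  n_horizontal (iter i E p) = i.
Proof.
move=> pD ip; have := count_iter_E i p; rewrite n_special_iter_E //.
have [_ /count_memPn + _] := pD; rewrite -/(n_horizontal p) => ->; lia.
Qed.

(** The final image is a lattice path by its grammar, and the property is pulled back along the
    remaining iterations. *)
Lemma lattice_path_iter_E_osd i p : odd_special_dyck p -> i <= n_special p ->
  lattice_path (iter i E p).
Proof.
move=> /odd_special_dyck_conv[f cpf] ip.
apply: (lattice_path_iter_E (n_special p - i)).
rewrite -iterD subnK // (iter_n_special_E _ _ cpf).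
exact/lattice_pathP/(conv_path0 _ _ _ cpf).
Qed.

Lemma iter_E_inj p q : odd_special_dyck p -> odd_special_dyck q ->
  n_special p = n_special q ->
  iter (n_special p) E p = iter (n_special p) E q -> p = q.
Proof.
move=> /odd_special_dyck_conv[f cpf] /odd_special_dyck_conv[g cqg] pq.
rewrite (iter_n_special_E _ _ cpf) pq (iter_n_special_E _ _ cqg) => fg.
by have [] := conv_inj _ _ _ _ _ [::] [::] cpf cqg isT isT; rewrite ?cats0.
Qed.

(** [E] is stationary once the special steps are used up, which bounds the exponent. *)
Lemma big_hybridP p : big_hybrid p <->
  exists d i, [/\ odd_special_dyck d, i <= n_special d & p = iter i E d].
Proof.
split=> [|[d [i [dD _ ->]]]]; last first.
  by elim: i => [|i IHi]; [apply: big_hybrid_base | apply: big_hybrid_E].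
elim=> {p} [p pD|p _ [d [i [dD id ->]]]]; first by exists p, 0.
have [ilt|] := ltnP i (n_special d); first by exists d, i.+1.
move=> di; exists d, i; split=> //; apply: E_no_special.
by apply/count_memPn; rewrite -/(n_special _) n_special_iter_E //; lia.
Qed.

(** Each effective iteration creates one horizontal step, so [k] determines the exponent. *)
Lemma hybridsP n j k p : hybrids n j k p <->
  exists d, [/\ odd_special_dyck d, plength d = n, n_special d = j + k & p = iter k E d].
Proof.
split=> [[_ /big_hybridP[d [i [dD id ->]]]]|[d [dD <- dj ->]]].
  rewrite plength_iter_E n_special_iter_E // n_horizontal_iter_E // => dn dj ik.
  by exists d; split=> //; [lia | rewrite ik].
have kd : k <= n_special d by rewrite dj leq_addl.
split; first exact: lattice_path_iter_E_osd.
- by apply/big_hybridP; exists d, k.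
- exact: plength_iter_E.
- by rewrite n_special_iter_E // dj addnK.
- exact: n_horizontal_iter_E.
Qed.

Lemma dyck_no_special_schroeder n : dyck_no_special n = schroeder_no_horizontal n.
Proof.
apply/seteqP; split=> p.
  by case=> -[pL pH _] pn /count_memPn pS; split=> //; apply/count_memPn.
case=> -[pL pS] pn /count_memPn pH; split=> //; last exact/count_memPn.
by split=> // i ilt iSp; move: pS; rewrite -iSp mem_nth.
Qed.

Theorem theorem1 (n : nat) :
  set_bij (dyck_no_special n) (schroeder_no_horizontal n) E /\
  (forall j k : nat, 1 <= j ->
     set_bij (hybrids n j k) (hybrids n (j - 1) (k + 1)) E).
Proof.
split=> [|j k j1].
  rewrite -dyck_no_special_schroeder.
  have E_id p : dyck_no_special n p -> E p = p.
    by case=> _ _ /count_memPn; apply: E_no_special.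
  split=> [p pD|p q|p pD]; first by rewrite E_id.
    by rewrite !inE => /E_id-> /E_id->.
  by exists p; rewrite ?E_id.
have jkE : j - 1 + (k + 1) = j + k by lia.
split=> [p|p q|p].
- move=> /hybridsP[d [dD dn dj ->]]; apply/hybridsP; exists d.
  by rewrite jkE addn1.
- rewrite !inE => /hybridsP[d [dD dn dj ->]] /hybridsP[e [eD en ej ->]] de.
  congr (iter k E _); apply: iter_E_inj; rewrite ?ej //.
  (* [de] equates the iterates of order [k + 1]; applying [E] another [j - 1] times uses up all
     special steps. *)
  by rewrite dj -jkE addn1 !iterD !iterS de.
(* The preimage is obtained by leaving out the last application of [E] to the same Dyck path. *)
- move=> /hybridsP[d [dD dn dj ->]]; exists (iter k E d); last by rewrite addn1.
  by apply/hybridsP; exists d; rewrite -jkE.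
Qed.
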